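(* Let $m\in\mathbb{N}$, $k=4m$, let $r\in\mathbb{N}$ be odd, $n\in\mathbb{Z}$, and let $\boldsymbol{a}=(a_1,\ldots,a_k)\in\mathbb{Z}^k$ satisfy $a_1\cdots a_k=1$ (in particular, $a_1=\cdots=a_k=1$ is allowed). Then $$N_{4m}(n,r,\boldsymbol{a})=r^{2m-1}\sum_{d\mid \gcd(n,r)} d\,J_{2m}(r/d).$$
   Context: $\mathbb{N}=\{1,2,\ldots\}$. For $k,r\in\mathbb{N}$, $n\in\mathbb{Z}$ and $\boldsymbol{a}=(a_1,\ldots,a_k)\in\mathbb{Z}^k$, $N_k(n,r,\boldsymbol{a})$ is the number of solutions $(x_1,\ldots,x_k)\in(\mathbb{Z}/r\mathbb{Z})^k$ (i.e. incongruent solutions mod $r$) of $a_1x_1^2+\cdots+a_kx_k^2\equiv n \pmod r$. $J_s$ is the Jordan function of order $s$: $J_s(q)=q^s\prod_{p\mid q}(1-1/p^s)$, product over the primes $p$ dividing $q$. The sum runs over positive divisors $d$ of $\gcd(n,r)$, with $\gcd(0,r)=r$. *)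

(* Defs.v *)
From mathcomp Require Import all_boot all_order all_algebra.

Set Implicit Arguments.
Unset Strict Implicit.
Unset Printing Implicit Defensive.

Import Order.TTheory GRing.Theory Num.Theory.
Local Open Scope ring_scope.

(* The classes modulo r are represented by the residues 0, ..., r - 1, i.e. by
   'I_r rather than by 'Z_r, which is not Z/rZ when r = 1. *)
Definition quad_sols (k : nat) (n : int) (r : nat) (a : 'I_k -> int)
    : {set {ffun 'I_k -> 'I_r}} :=
  [set x : {ffun 'I_k -> 'I_r} |
    (\sum_(i < k) a i * (x i)%:Z ^+ 2 == n %[mod r%:Z])%Z].

Definition num_quad_sols (k : nat) (n : int) (r : nat) (a : 'I_k -> int) : nat :=
  #|quad_sols n r a|.

(* J_s(q) = q^s * prod_(p | q) (1 - 1/p^s), rational-valued because of the quotients;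
   meaningful for q > 0. *)
Definition jordan (s q : nat) : rat :=
  q%:R ^+ s * \prod_(p <- primes q) (1 - 1 / p%:R ^+ s).

(* Main.v *)
(* The coefficients are all 1 or -1, with an even number of -1. Counting solutions of a
   diagonal equation is a convolution product of the distributions of its terms, so the
   order of the variables does not matter. As r is odd, -1 = u^2 + v^2 in Z/r, hence
   x^2 + y^2 and - (x^2 + y^2) have the same distribution; one can thus assume that half
   of the signs are negative, and x^2 - y^2 has the distribution of the product x y since
   2 is invertible. So N is the number of pairs of vectors u, v in (Z/r)^(2m) with
   u . v = n. For fixed u with D = gcd(u_1, ..., u_2m, r) there are D r^(2m-1) such v
   if D divides n and none otherwise, and the number of u with gcd D is J_2m(r/D), by
   inclusion-exclusion over the primes dividing r/D. *)
From HB Require Import structures.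
Require Import Defs.
From mathcomp Require Import all_boot all_order all_algebra.
From mathcomp Require Import ring zify.

Set Implicit Arguments.
Unset Strict Implicit.
Unset Printing Implicit Defensive.

Import Order.TTheory GRing.Theory Num.Theory.
Local Open Scope ring_scope.

(** * Convolution and fibre counts on finite abelian groups *)

Definition convol (G : finZmodType) (f g : {ffun G -> nat}) : {ffun G -> nat} :=
  [ffun z => (\sum_x f x * g (z - x)%R)%N].

Definition convol1 (G : finZmodType) : {ffun G -> nat} := [ffun z => (z == 0) : nat].

Lemma convolC (G : finZmodType) : commutative (@convol G).
Proof.
move=> f g; apply/ffunP=> z; rewrite !ffunE.
rewrite (reindex_inj (inj_comp (addrI z) oppr_inj)) /=.
by apply: eq_bigr => x _; rewrite opprD opprK addNKr mulnC.
Qed.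

Lemma convol1f (G : finZmodType) : left_id (@convol1 G) (@convol G).
Proof.
move=> f; apply/ffunP=> z; rewrite ffunE (bigD1 0) //= ffunE eqxx mul1n subr0.
by rewrite big1 ?addn0 // => x /negPf x0; rewrite ffunE x0.
Qed.

Lemma convolA (G : finZmodType) : associative (@convol G).
Proof.
move=> f g h; apply/ffunP=> z; rewrite !ffunE.
under [RHS]eq_bigr => w _ do rewrite ffunE big_distrl.
rewrite /= exchange_big; apply: eq_bigr => x _ /=.
rewrite ffunE big_distrr (reindex_inj (addIr (- x))) /=.
by apply: eq_bigr => w _; rewrite mulnA opprB addrA subrK.
Qed.

HB.instance Definition _ (G : finZmodType) :=
  Monoid.isComLaw.Build {ffun G -> nat} (convol1 G) (@convol G)
    (@convolA G) (@convolC G) (@convol1f G).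

Definition fibre_card (G : finZmodType) (X : finType) (f : X -> G) : {ffun G -> nat} :=
  [ffun z => #|[set x | f x == z]|].

Lemma fibre_cardE (G : finZmodType) (X : finType) (f : X -> G) z :
  fibre_card f z = (\sum_x (f x == z))%N.
Proof.
by rewrite ffunE -sum1_card big_mkcond; apply: eq_bigr => x _; rewrite inE; case: eqP.
Qed.

Lemma fibre_card_bij (G : finZmodType) (X Y : finType) (f : X -> G) (g : Y -> G)
    (h : Y -> X) : bijective h -> f \o h =1 g -> fibre_card f = fibre_card g.
Proof.
move=> bij_h fh; apply/ffunP=> z; rewrite !fibre_cardE.
rewrite (reindex h) /=; last exact: onW_bij.
by apply: eq_bigr => y _; rewrite -fh.
Qed.

Lemma convol_fibre_card (G : finZmodType) (X Y : finType) (f : X -> G) (g : Y -> G) :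
  convol (fibre_card f) (fibre_card g) = fibre_card (fun p : X * Y => f p.1 + g p.2).
Proof.
apply/ffunP=> z; rewrite ffunE fibre_cardE -(pair_bigA _ (fun x y => (f x + g y == z) : nat)).
under eq_bigr => w _ do rewrite fibre_cardE big_distrl.
rewrite [LHS]exchange_big; apply: eq_bigr => x _ /=.
rewrite (bigD1 (f x)) //= eqxx mul1n big1 ?addn0 => [|w /negPf fxw]; last first.
  by rewrite eq_sym fxw.
by rewrite fibre_cardE; apply: eq_bigr => y _; rewrite eq_sym subr_eq addrC eq_sym.
Qed.

Lemma big_convol_fibre_card (G : finZmodType) (X : finType) k (f : 'I_k -> X -> G) :
  \big[@convol G/convol1 G]_(i < k) fibre_card (f i) =
  fibre_card (fun x : {ffun 'I_k -> X} => \sum_i f i (x i)).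
Proof.
elim: k f => [|k IHk] f.
  apply/ffunP=> z; rewrite big_ord0 fibre_cardE ffunE.
  under eq_bigr => x _ do rewrite big_ord0 eq_sym.
  by rewrite sum_nat_const card_ffun card_ord expn0 mul1n.
rewrite big_ord_recl IHk convol_fibre_card; apply/esym.
apply: (@fibre_card_bij _ _ _ _ _
  (fun p : X * {ffun 'I_k -> X} =>
     [ffun i : 'I_k.+1 => if unlift ord0 i is Some j then p.2 j else p.1])).
  exists (fun x : {ffun 'I_k.+1 -> X} => (x ord0, [ffun j => x (lift ord0 j)])).
    move=> [x y]; rewrite /= ffunE unlift_none; congr (_, _).
    by apply/ffunP=> j; rewrite !ffunE liftK.
  by move=> x; apply/ffunP=> i; rewrite ffunE; case: unliftP => [j|] -> //=; rewrite ffunE.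
move=> [x y] /=; rewrite big_ord_recl ffunE unlift_none; congr (_ + _).
by apply: eq_bigr => j _; rewrite ffunE liftK.
Qed.

(** * Balancing the signs and changing variables in binary forms *)

(** Only the number of factors [y] matters. As [x] and [y] have the same square, an even power of
    [y] can be traded for that of [x]: the product becomes [x] to the power [4 * m], and half of it
    is then traded back. *)
Lemma big_op_balance_signs (T : Type) (idx : T) (op : Monoid.com_law idx) (x y : T) (m : nat)
    (P : pred 'I_(4 * m)) :
  op x x = op y y -> ~~ odd #|P| ->
  \big[op/idx]_(i < 4 * m) (if P i then y else x) = \big[op/idx]_(i < 2 * m) op x y.
Proof.
move=> xy oddP.
pose pw z n := \big[op/idx]_(i < n) z.
have pwD z n1 n2 : pw z (n1 + n2)%N = op (pw z n1) (pw z n2) by rewrite /pw big_split_ord.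
have pwM z t n : pw (op z t) n = op (pw z n) (pw t n) by rewrite /pw big_split.
have pw2 n : pw x n.*2 = pw y n.*2 by rewrite -addnn !pwD -!pwM xy.
have pw_card z (Q : pred 'I_(4 * m)) : \big[op/idx]_(i | Q i) z = pw z #|Q|.
  by rewrite /pw !big_const card_ord.
rewrite (bigID P) /=.
under eq_bigr => i Pi do rewrite Pi.
under [X in op _ X]eq_bigr => i /negPf Pi do rewrite Pi.
rewrite (pw_card y) (pw_card x) -[#|P|]even_halfK // -pw2 even_halfK // -pwD cardC card_ord.
rewrite -/(pw _ _) pwM (mulnDl 2 2 m) pwD; congr (op _ _).
by rewrite mul2n pw2.
Qed.

(** Multiplication by [u + i v], with [i ^ 2 = -1], multiplies the norm [x ^ 2 + y ^ 2] by -1. Its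
    inverse is multiplication by minus the conjugate. *)
Lemma convol_squares_neg (R : finComNzRingType) (u v : R) :
  u ^+ 2 + v ^+ 2 = -1 ->
  let q (e : R) := fibre_card (fun x : R => e * x ^+ 2) in
  convol (q 1) (q 1) = convol (q (-1)) (q (-1)).
Proof.
move=> uv q; rewrite !convol_fibre_card.
apply: (@fibre_card_bij _ _ _ _ _
  (fun p => (u * p.1 - v * p.2, v * p.1 + u * p.2))).
  have uvK x : - (u ^+ 2 + v ^+ 2) * x = x by rewrite uv opprK mul1r.
  exists (fun p => (- (u * p.1 + v * p.2), v * p.1 - u * p.2)) => -[x y] /=;
    by congr (_, _); rewrite -[RHS]uvK; ring.
by move=> [x y] /=; rewrite -uv; ring.
Qed.

Lemma convol_squares_hyperbolic (R : finComNzRingType) (h : R) : 2 * h = 1 ->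
  let q e := fibre_card (fun x : R => e * x ^+ 2) in
  convol (q 1) (q (-1)) = fibre_card (fun p : R * R => p.1 * p.2).
Proof.
move=> h2 q; rewrite !convol_fibre_card; apply/esym.
apply: (@fibre_card_bij _ _ _ _ _ (fun p => (p.1 + p.2, p.1 - p.2))).
  have hK x : (2 * h) * x = x by rewrite h2 mul1r.
  exists (fun p => (h * (p.1 + p.2), h * (p.1 - p.2))) => -[x y] /=;
    by congr (_, _); rewrite -[RHS]hK; ring.
by move=> [x y] /=; ring.
Qed.

(** * -1 as a sum of two squares modulo an odd number *)

Lemma neg1_sum_two_squares_prime (p : nat) : prime p -> odd p ->
  exists u v : int, (p%:Z %| u ^+ 2 + v ^+ 2 + 1)%Z.
Proof.
move=> p_pr p_odd; have p_gt1 := prime_gt1 p_pr.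
pose sq (i : 'I_(p./2.+1)) : 'F_p := i%:R ^+ 2.
have natF0 k : (k%:R == 0 :> 'F_p) = (p %| k)%N.
  by rewrite -(dvdn_pcharf (pchar_Fp p_pr)).
(* Equal squares give [p] dividing [(j - i) * (j + i)]; since [i] and [j] are at most [(p - 1) / 2],
   both factors are below [p], so one of them is 0. *)
have sq_inj : injective sq.
  move=> i j /eqP; rewrite /sq.
  wlog le_ij : i j / (i <= j)%N => [IH|].
    case: (leqP i j) => [/IH //|/ltnW/IH ji]; rewrite eq_sym => /ji -> //.
  rewrite eq_sym -subr_eq0 subr_sqr -natrB // -natrD -natrM natF0.
  move: (ltn_ord i) (ltn_ord j) (odd_double_half p); rewrite p_odd Euclid_dvdM // => ip jp hp.
  move=> pij; apply/val_inj => /=; apply/eqP; rewrite eqn_leq le_ij -subn_eq0 /=.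
  case/orP: pij => /dvdnP [[|q] hq]; move: ip jp hp hq le_ij; rewrite -?muln2 /=; nia.
(* Both sets have (p + 1) / 2 elements, so they meet. *)
pose A := [set sq i | i in 'I_(p./2.+1)]; pose B := [set - 1 - sq i | i in 'I_(p./2.+1)].
have cA : #|A| = p./2.+1 by rewrite card_imset // card_ord.
have cB : #|B| = p./2.+1.
  by rewrite card_imset ?card_ord // => i j /addrI /oppr_inj /sq_inj.
have /set0Pn [z /setIP [/imsetP [i _ zi] /imsetP [j _ zj]]] : A :&: B != set0.
  apply/negP => /eqP AB0; have := max_card (A :|: B).
  rewrite cardsU AB0 cards0 subn0 cA cB card_Fp //.
  by move: (odd_double_half p); rewrite p_odd; lia.
exists (i : nat)%:Z, (j : nat)%:Z; rewrite dvdzE -natF0.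
rewrite -[`|_|%N]/(i ^ 2 + j ^ 2 + 1)%N !natrD !natrX.
by rewrite -[_ ^+ 2]/(sq i) -zi zj /sq; apply/eqP; ring.
Qed.

(** Hensel lifting in [u] alone: the derivative [2 * u] is invertible modulo [p], and the quadratic
    error, a multiple of [s * s], vanishes modulo [p * s] because [p] divides [s]. *)
Lemma neg1_sum_two_squares_lift (p s : nat) (u v : int) :
  prime p -> odd p -> (p %| s)%N -> ~~ (p%:Z %| u)%Z ->
  (s%:Z %| u ^+ 2 + v ^+ 2 + 1)%Z ->
  exists u' : int, ((p * s)%:Z %| u' ^+ 2 + v ^+ 2 + 1)%Z.
Proof.
move=> p_pr p_odd /dvdnP [q sq] pu /dvdzP ht.
have {ht} [t ht] : exists t : int, u ^+ 2 + v ^+ 2 + 1 = t * s by [].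
have cop : coprimez (2 * u) p.
  rewrite coprimezE coprime_sym abszM prime_coprime // Euclid_dvdM // negb_or.
  move: pu; rewrite dvdzE => ->; rewrite andbT.
  by move: p_odd; case: (p) p_pr => [|[|[|]]].
have [x [y xy]] : exists x y : int, x * (2 * u) + y * p = 1.
  by have [[x y] xy] := coprimezP _ _ cop; exists x, y.
(* Newton step: x is the inverse of 2 * u modulo p. *)
exists (u - x * t * s); apply/dvdzP; exists (t * y + q%:Z * (x * t) ^+ 2).
rewrite PoszM; have -> : (u - x * t * s) ^+ 2 + v ^+ 2 + 1 =
  (u ^+ 2 + v ^+ 2 + 1) - (2 * u * x * t) * s + (x * t) ^+ 2 * (s * s) by ring.
have {}xy : 2 * u * x = 1 - y * p.
  by apply: (addIr (y * p)); rewrite subrK [2 * u * x]mulrC xy.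
rewrite ht xy sq PoszM; ring.
Qed.

(** Strong induction, removing the least prime factor [p] from [r = p * s]: a solution modulo [s] is
    lifted if [p] divides [s], and otherwise glued to one modulo [p] by the Chinese remainder
    theorem. *)
Lemma neg1_sum_two_squares (r : nat) : odd r ->
  exists u v : int, (r%:Z %| u ^+ 2 + v ^+ 2 + 1)%Z.
Proof.
elim/ltn_ind: r => r IHr r_odd; case: (leqP r 1) => [r1|r_gt1].
  have -> : r = 1%N by case: (r) r_odd r1 => [|[|]].
  by exists 0, 0; rewrite dvd1z.
have p_pr := pdiv_prime r_gt1; set p := pdiv r in p_pr.
have [s rs] : exists s, r = (p * s)%N.
  by have /dvdnP [s ->] := pdiv_dvd r; exists s; rewrite mulnC.
move: r_odd; rewrite rs oddM => /andP [p_odd s_odd].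
have [|u [v uv]] := IHr s _ s_odd.
  by rewrite rs ltn_Pmull ?prime_gt1 //; case: (s) s_odd.
have [ps|ps] := boolP (p %| s)%N.
  have [pu|pu] := boolP (p%:Z %| u)%Z; last first.
    by have [u' hu'] := neg1_sum_two_squares_lift p_pr p_odd ps pu uv; exists u', v.
  (* If [p] divided both [u] and [v], it would divide 1; so the lifting can be done in [v]. *)
  have pv : ~~ (p%:Z %| v)%Z.
    apply/negP => pv; have : (p%:Z %| u ^+ 2 + v ^+ 2 + 1)%Z by apply: dvdz_trans uv.
    rewrite rpredDl ?dvdz1; last by rewrite rpredD // exprS dvdz_mulr.
    by case: (p) p_pr => [|[|]].
  rewrite [u ^+ 2 + _]addrC in uv.
  have [v' hv'] := neg1_sum_two_squares_lift p_pr p_odd ps pv uv.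
  by exists u, v'; rewrite [u ^+ 2 + _]addrC.
have [x [y xy]] := neg1_sum_two_squares_prime p_pr p_odd.
have cop : coprimez p s by rewrite coprimezE prime_coprime.
exists (zchinese p s x u), (zchinese p s y v).
rewrite PoszM Gauss_dvdz //.
have lift (d : int) z z' w w' : (z = z' %[mod d])%Z -> (w = w' %[mod d])%Z ->
  (d %| z' ^+ 2 + w' ^+ 2 + 1)%Z -> (d %| z ^+ 2 + w ^+ 2 + 1)%Z.
  move=> /eqP + /eqP; rewrite !eqz_mod_dvd => hz hw hzw.
  have -> : z ^+ 2 + w ^+ 2 + 1 =
    (z - z') * (z + z') + (w - w') * (w + w') + (z' ^+ 2 + w' ^+ 2 + 1) by ring.
  apply: rpredD hzw; apply: rpredD; [move: hz | move: hw] => /dvdzP [k ->];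
    by rewrite mulrAC dvdz_mull.
by apply/andP; split; [apply: lift xy | apply: lift uv];
  rewrite ?zchinese_modl ?zchinese_modr.
Qed.

(** * Counting tuples with a given gcd *)

(** Including [r] makes the gcd depend on the residue classes only; the zero tuple gets [r]. *)
Definition gcd_family (s r : nat) (u : {ffun 'I_s -> 'I_r}) : nat :=
  gcdn r (\big[gcdn/0%N]_i u i).

Lemma dvdn_gcd_family (s r e : nat) (u : {ffun 'I_s -> 'I_r}) :
  (e %| gcd_family u)%N = (e %| r)%N && [forall i, e %| u i]%N.
Proof.
by rewrite dvdn_gcd; congr (_ && _); apply/dvdn_biggcdP/forallP => h i //; apply: h.
Qed.

Lemma card_dvdn_ord (r e : nat) : (e %| r)%N -> (0 < r)%N ->
  #|[pred i : 'I_r | e %| i]%N| = (r %/ e)%N.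
Proof.
move=> + r_gt0; rewrite divn_count_dvd -sum1_card big_mkcond /=.
rewrite (eq_bigr (fun i : 'I_r => (e %| i) : nat)) => [|i _]; last by rewrite inE; case: ifP.
rewrite -(big_mkord xpredT (fun i => (e %| i) : nat)).
case: r r_gt0 => // r _ er.
(* The known count runs over 1, ..., r and this one over 0, ..., r - 1; the endpoints 0 and r are
   both multiples of [e]. *)
by rewrite big_nat_recl // dvdn0 big_nat_recr //= er addnC big_add1.
Qed.

Lemma card_dvdn_gcd_family (s r e : nat) : (e %| r)%N -> (0 < r)%N ->
  #|[set u : {ffun 'I_s -> 'I_r} | e %| gcd_family u]%N| = ((r %/ e) ^ s)%N.
Proof.
move=> er r_gt0; rewrite -(card_dvdn_ord er r_gt0) -[X in (_ ^ X)%N]card_ord -card_ffun_on.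
apply: eq_card => u; rewrite inE dvdn_gcd_family er /=.
apply/forallP/ffun_onP => eu i; first by rewrite inE; apply: eu.
by have := eu i; rewrite inE.
Qed.

(* The factor e makes the induction on ps go through: the tuples to be removed for
   the next prime p are those counted with e * p in place of e. *)
Lemma card_gcd_family_sieve (s r e : nat) (ps : seq nat) :
  (0 < r)%N -> uniq ps -> all prime ps -> (e * \prod_(p <- ps) p %| r)%N ->
  #|[set u : {ffun 'I_s -> 'I_r} | (e %| gcd_family u)%N &&
     all (fun p => ~~ (e * p %| gcd_family u)%N) ps]|%:R =
  (r %/ e)%:R ^+ s * \prod_(p <- ps) (1 - 1 / p%:R ^+ s) :> rat.
Proof.
move=> r_gt0; elim: ps e => [|p ps IH] e.
  rewrite !big_nil muln1 mulr1 -natrX => _ _ er; rewrite -(card_dvdn_gcd_family s er r_gt0).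
  by congr (_%:R); apply: eq_card => u; rewrite !inE andbT.
move=> /= /andP [p_ps uniq_ps] /andP [p_pr ps_pr]; rewrite !big_cons mulnA => epr.
have epr' : (e * p %| r)%N by apply: dvdn_trans epr; apply: dvdn_mulr.
have IHep := IH (e * p)%N uniq_ps ps_pr epr.
have IHe := IH e uniq_ps ps_pr (dvdn_trans _ epr).
rewrite {IH}mulnAC dvdn_mulr // in IHe; have {}IHe := IHe isT.
have := cardsID [set u : {ffun 'I_s -> 'I_r} | e * p %| gcd_family u]%N
  [set u | (e %| gcd_family u)%N && all (fun q => ~~ (e * q %| gcd_family u)%N) ps].
set B := _ :\: _; set A := _ :&: _ => /(congr1 (fun k => k%:R : rat)).
rewrite natrD {}IHe.
(* Since [p] and [q] are coprime, once [e * p] divides the gcd, divisibility by [e * q] amounts to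
   divisibility by [e * p * q]. So [A] is an instance of the induction hypothesis at [e * p]. *)
have -> : A = [set u : {ffun 'I_s -> 'I_r} | (e * p %| gcd_family u)%N &&
     all (fun q => ~~ (e * p * q %| gcd_family u)%N) ps].
  apply/setP=> u; rewrite !inE andbC.
  have [epu|//] := boolP (e * p %| _)%N; rewrite (dvdn_trans _ epu) ?dvdn_mulr //=.
  apply: eq_in_all => q qps; congr (~~ _).
  have q_pr := allP ps_pr q qps.
  have pq : coprime p q.
    by rewrite prime_coprime // dvdn_prime2 //; apply: contraNneq p_ps => ->.
  have e_gt0 : (0 < e)%N by case: (e) epr' r_gt0 => //; rewrite mul0n dvd0n => /eqP ->.
  move: epu; have [euT|] := boolP (e %| gcd_family u)%N; last first.
    by move=> neu epu; case/negP: neu; apply: dvdn_trans epu; apply: dvdn_mulr.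
  case/dvdnP: euT => k ->; rewrite -mulnA ![(e * _)%N]mulnC !dvdn_pmul2r //.
  by move=> pk; rewrite Gauss_dvd // pk.
rewrite {}IHep.
have -> : B = [set u : {ffun 'I_s -> 'I_r} | [&& (e %| gcd_family u)%N,
     ~~ (e * p %| gcd_family u)%N & all (fun q => ~~ (e * q %| gcd_family u)%N) ps]].
  by apply/setP=> u; rewrite !inE andbCA.
move=> /(canRL (addKr _)) ->.
have /dvdnP [k rk] := epr'; have p0 : p%:R != 0 :> rat by rewrite pnatr_eq0 -lt0n prime_gt0.
have ep_gt0 : (0 < e * p)%N by case: (e * p)%N epr' r_gt0 => //; rewrite dvd0n => /eqP ->.
have e_gt0 : (0 < e)%N by case: (e) ep_gt0.
have -> : (r %/ (e * p) = k)%N by rewrite rk mulnK.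
have -> : (r %/ e = k * p)%N by rewrite rk mulnCA mulKn.
rewrite natrM exprMn.
by field; rewrite expf_neq0.
Qed.

(** The sieve is applied with [e = d] and the primes of [r %/ d]: a gcd [k * d] with [k > 1] is
    excluded by any prime factor of [k]. *)
Lemma card_gcd_family (s r d : nat) : (0 < r)%N -> (d %| r)%N ->
  #|[set u : {ffun 'I_s -> 'I_r} | gcd_family u == d]|%:R = jordan s (r %/ d).
Proof.
move=> r_gt0 dr; have d_gt0 : (0 < d)%N := dvdn_gt0 r_gt0 dr.
have q_gt0 : (0 < r %/ d)%N by rewrite divn_gt0 // dvdn_leq.
have prime_primes : all prime (primes (r %/ d)).
  by apply/allP => p; rewrite mem_primes => /andP [].
have prod_primes : (d * \prod_(p <- primes (r %/ d)) p %| r)%N.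
  rewrite -[X in (_ %| X)%N](divnK dr) mulnC dvdn_pmul2r //.
  rewrite [X in (_ %| X)%N]prod_prime_decomp // prime_decompE big_map.
  rewrite big_seq [X in (_ %| X)%N]big_seq.
  elim/big_ind2: _ => //= [a b a' b'|p]; first exact: dvdn_mul.
  by rewrite -logn_gt0; case: logn => // l _; rewrite expnS dvdn_mulr.
rewrite /jordan -(card_gcd_family_sieve s r_gt0 (primes_uniq _) prime_primes prod_primes).
congr (_%:R); apply: eq_card => u; rewrite !inE.
apply/eqP/andP => [->|[/dvdnP [k uk] /allP du]].
  split=> //; apply/allP => p; rewrite mem_primes => /andP [p_pr _].
  apply/negP => /dvdn_leq; move/(_ d_gt0); rewrite -[X in (_ <= X)%N]muln1 leq_pmul2l //.
  by rewrite leqNgt prime_gt1.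
have kd : (k * d %| r)%N by rewrite -uk dvdn_gcdl.
case: (ltngtP k 1) => [k_lt1|k_gt1|k1]; last by rewrite uk k1 mul1n.
  by have := dvdn_gt0 r_gt0 kd; case: (k) k_lt1.
have k_primes : pdiv k \in primes (r %/ d).
  rewrite mem_primes pdiv_prime // q_gt0 (dvdn_trans (pdiv_dvd k)) //.
  by rewrite -(dvdn_pmul2r d_gt0) divnK.
by case/negP: (du _ k_primes); rewrite uk mulnC dvdn_pmul2r // pdiv_dvd.
Qed.

(** * Values and fibres of a linear form modulo [r.+2] *)

Lemma dvdn_Zp_nat (r d k : nat) : (d %| r.+2)%N -> (d %| (k%:R : 'I_r.+2))%N = (d %| k)%N.
Proof. by move=> dr; rewrite (@val_Zp_nat r.+2) // /dvdn modn_dvdm. Qed.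

(** The image is an ideal containing every [u i], so by Bezout it contains their gcd with the
    modulus. *)
Lemma linear_form_image (s r : nat) (u : {ffun 'I_s -> 'I_r.+2}) (n : 'I_r.+2) :
  (exists v : {ffun 'I_s -> 'I_r.+2}, \sum_i u i * v i = n) <-> (gcd_family u %| n)%N.
Proof.
have := dvdnn (gcd_family u); rewrite dvdn_gcd_family => /andP [Dr /forallP Du].
split=> [[v <-]|/dvdnP [k nk]].
  have -> : \sum_i u i * v i = (\sum_i u i * v i)%N%:R.
    by rewrite natr_sum; apply: eq_bigr => i _; rewrite natrM !natr_Zp.
  by rewrite dvdn_Zp_nat //; apply: dvdn_sum => i _; apply: dvdn_mulr.
pose im (x : 'I_r.+2) := exists v : {ffun 'I_s -> 'I_r.+2}, \sum_i u i * v i = x.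
have imM x a : im x -> im (a * x).
  case=> v <-; exists [ffun i => a * v i]; rewrite mulr_sumr.
  by apply: eq_bigr => i _; rewrite ffunE mulrCA.
have imB x y : im x -> im y -> im (x - y).
  case=> v <- [w <-]; exists [ffun i => v i - w i]; rewrite -sumrB.
  by apply: eq_bigr => i _; rewrite ffunE mulrBr.
have im0 : im 0 by exists [ffun=> 0]; rewrite big1 // => i _; rewrite ffunE mulr0.
have im_gcd a b : im a%:R -> im b%:R -> im (gcdn a b)%:R.
  case: (posnP a) => [->|a_gt0]; first by rewrite gcd0n.
  have [c _ /dvdnP [q hq]] := Bezoutl b a_gt0; move=> ima imb.
  have -> : (gcdn a b)%:R = q%:R * a%:R - c%:R * b%:R :> 'I_r.+2.
    by rewrite -!natrM -hq natrD addrK.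
  by apply: imB; apply: imM.
suff : im (gcd_family u)%:R by move/(imM _ k%:R); rewrite -natrM -nk natr_Zp.
(* The modulus itself is in the image, being 0 in the ring. *)
apply: (im_gcd _ _); first by rewrite (@pchar_Zp r.+2).
elim/big_ind: _ => [|a b|i _]; [exact: im0 | exact: im_gcd | rewrite natr_Zp].
exists [ffun j => (j == i)%:R]; rewrite (bigD1 i) //= ffunE eqxx mulr1 big1 ?addr0 //.
by move=> j /negPf ji; rewrite ffunE ji mulr0.
Qed.

(** Nonempty fibres are cosets of the kernel [K], and [r.+2 %/ gcd_family u] values are attained.
    The factor [r.+2] on the left avoids the exponent [s - 1], which would be truncated at
    [s = 0]. *)
Lemma card_linear_form (s r : nat) (u : {ffun 'I_s -> 'I_r.+2}) (n : 'I_r.+2) :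
  (#|[set v : {ffun 'I_s -> 'I_r.+2} | (\sum_i u i * v i)%R == n]| * r.+2 =
   if gcd_family u %| n then gcd_family u * r.+2 ^ s else 0)%N.
Proof.
pose phi (v : {ffun 'I_s -> 'I_r.+2}) := \sum_i u i * v i.
pose K := [set v | phi v == 0].
have fib x : #|[set v | phi v == x]| = if (gcd_family u %| x)%N then #|K| else 0%N.
  case: ifP => [/linear_form_image [w wx]|nDx].
    rewrite -(card_imset K (addrI w)); apply: eq_card => v; rewrite inE.
    have phiD a b : phi (a + b) = phi a + phi b.
      by rewrite -big_split; apply: eq_bigr => i _; rewrite ffunE mulrDr.
    apply/eqP/imsetP => [vx|[t + ->]]; last first.
      by rewrite inE phiD => /eqP ->; rewrite addr0.
    exists (v - w); last by rewrite addrC subrK.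
    by rewrite inE; apply/eqP/(addIr (phi w)); rewrite -phiD subrK vx add0r.
  apply: eq_card0 => v; rewrite inE; apply/negP => /eqP vx.
  by move/negP: nDx; apply; apply/linear_form_image; exists v.
have Dr : (gcd_family u %| r.+2)%N by apply: dvdn_gcdl.
have cardK : (#|K| * (r.+2 %/ gcd_family u) = r.+2 ^ s)%N.
  rewrite -[in RHS](card_ord s) -[in RHS](card_ord r.+2) -card_ffun -[RHS]sum1_card.
  rewrite [RHS](partition_big phi xpredT) //= -card_dvdn_ord // mulnC -sum_nat_const.
  rewrite big_mkcond; apply: eq_bigr => x _; rewrite inE -fib -sum1_card.
  by apply: eq_bigl => v; rewrite inE.
by rewrite fib; case: ifP => // _; rewrite -cardK mulnCA (mulnC (gcd_family u)) divnK.
Qed.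

Lemma sum_gcd_family (s r : nat) (n : 'I_r.+2) :
  (\sum_(u : {ffun 'I_s.+1 -> 'I_r.+2})
     #|[set v : {ffun 'I_s.+1 -> 'I_r.+2} | (\sum_i u i * v i)%R == n]|)%N%:R =
  r.+2%:R ^+ s * \sum_(d <- divisors (gcdn n r.+2)) d%:R * jordan s.+1 (r.+2 %/ d) :> rat.
Proof.
have g_gt0 : (0 < gcdn n r.+2)%N by rewrite gcdn_gt0 orbT.
have r0 : r.+2%:R != 0 :> rat by rewrite pnatr_eq0.
(* Each count is written as a sum over [d] with at most one term, so that exchanging the sums groups
   the [u] by their gcd. *)
rewrite natr_sum (eq_bigr (fun u : {ffun 'I_s.+1 -> 'I_r.+2} =>
  \sum_(d <- divisors (gcdn n r.+2) | gcd_family u == d) r.+2%:R ^+ s * d%:R)) => [|u _].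
  rewrite (exchange_big_dep xpredT) //= mulr_sumr; apply: eq_big_seq => d.
  rewrite -dvdn_divisors // dvdn_gcd => /andP [_ dr].
  rewrite -card_gcd_family // mulrA [RHS]mulr_natr -sumr_const.
  by apply: eq_bigl => u; rewrite inE.
apply: (mulIf r0); rewrite -natrM card_linear_form.
have -> : (gcd_family u %| n)%N = (gcd_family u \in divisors (gcdn n r.+2)).
  by rewrite -dvdn_divisors // dvdn_gcd dvdn_gcdl andbT.
case: ifP => [Dg|/negP nDg].
  rewrite big_mkcond (bigD1_seq (gcd_family u)) ?divisors_uniq //= eqxx.
  rewrite big1 ?addr0 => [|d]; last by rewrite eq_sym => /negPf ->.
  by rewrite natrM natrX exprSr; ring.
by rewrite big1_seq ?mul0r // => d /andP [/eqP <-].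
Qed.

(** * From integer congruences to the ring, and the final count *)

Lemma eqz_modE_Zp (r : nat) (x y : int) :
  (x == y %[mod r.+2])%Z = (x%:~R == y%:~R :> 'I_r.+2).
Proof.
rewrite eqz_mod_dvd -[RHS]subr_eq0 -rmorphB dvdzE /=.
have Zp_nat0 k : (k%:R == 0 :> 'I_r.+2) = (r.+2 %| k)%N.
  by rewrite -val_eqE /= (@val_Zp_nat r.+2).
by case: (x - y) => k; rewrite ?NegzE ?mulrNz ?oppr_eq0 -Zp_nat0.
Qed.

Lemma gcdn_intr_Zp (r : nat) (n : int) : gcdn (n%:~R : 'I_r.+2) r.+2 = gcdn `|n| r.+2.
Proof.
set x : 'I_r.+2 := n%:~R.
have /eqP xn : ((x : nat)%:Z == n %[mod r.+2])%Z by rewrite eqz_modE_Zp -pmulrn natr_Zp.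
by have := gcdz_modl n r.+2; rewrite -xn gcdz_modl => -[].
Qed.

(** Each coefficient is a unit of the integers, and the product is -1 to the power of the number of
    negative ones. *)
Lemma prod_eq1_sign (k : nat) (a : 'I_k -> int) : \prod_i a i = 1 ->
  (forall i, a i = if a i == -1 then -1 else 1) /\ ~~ odd #|[pred i | a i == -1]|.
Proof.
move=> a1; have sgn i : a i = if a i == -1 then -1 else 1.
  have : a i \is a GRing.unit.
    have : \prod_i a i \is a GRing.unit by rewrite a1 unitr1.
    by rewrite (bigD1 i) //= unitrM => /andP [].
  by case: ifP => [/eqP //|]; rewrite unfold_in /= => -> /orP [/eqP|].
split=> //; move: a1; under eq_bigr => i _ do rewrite sgn.
by rewrite -big_mkcond /= prodr_const -signr_odd; case: odd.
Qed.

Lemma num_quad_sols_hyperbolic (m r : nat) (n : int) (a : 'I_(4 * m) -> int) :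
  odd r.+2 -> \prod_i a i = 1 ->
  num_quad_sols n r.+2 a =
  (\sum_(u : {ffun 'I_(2 * m) -> 'I_r.+2})
     #|[set v : {ffun 'I_(2 * m) -> 'I_r.+2} | (\sum_i u i * v i)%R == n%:~R]|)%N.
Proof.
move=> r_odd /prod_eq1_sign [sgn even_neg].
pose q (e : 'I_r.+2) := fibre_card (fun x : 'I_r.+2 => e * x ^+ 2).
have [s [t /dvdzP [w st]]] := neg1_sum_two_squares r_odd.
have r0 : r.+2%:R = 0 :> 'I_r.+2 by rewrite (@pchar_Zp r.+2).
have qq : convol (q 1) (q 1) = convol (q (-1)) (q (-1)).
  apply: (@convol_squares_neg _ s%:~R t%:~R); apply/eqP; rewrite -addr_eq0.
  by rewrite -!rmorphXn -rmorphD -[1]/(1%:~R) -rmorphD st rmorphM /= -pmulrn r0 mulr0.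
have qh : convol (q 1) (q (-1)) = fibre_card (fun p : 'I_r.+2 * 'I_r.+2 => p.1 * p.2).
  (* Half of the modulus plus one is the inverse of 2, the modulus being odd. *)
  apply: (@convol_squares_hyperbolic _ (r.+3./2)%:R).
  rewrite -natrM mul2n even_halfK /=; last first.
    by move: r_odd; rewrite /= !negbK.
  by rewrite -[r.+3]add1n natrD r0 addr0.
have -> : num_quad_sols n r.+2 a =
    fibre_card (fun x : {ffun 'I_(4 * m) -> 'I_r.+2} => \sum_i (a i)%:~R * x i ^+ 2) n%:~R.
  rewrite ffunE; apply: eq_card => x; rewrite !inE eqz_modE_Zp rmorph_sum /=.
  congr (_ == _); apply: eq_bigr => i _.
  by rewrite rmorphM rmorphXn /= -pmulrn natr_Zp.
rewrite -(big_convol_fibre_card (fun i (x : 'I_r.+2) => (a i)%:~R * x ^+ 2)).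
rewrite (eq_bigr (fun i => if a i == -1 then q (-1) else q 1)) => [|i _]; last first.
  by rewrite [in LHS]sgn; case: ifP.
rewrite (big_op_balance_signs qq even_neg) /= qh big_convol_fibre_card.
(* A tuple of pairs is now read as a pair of tuples. *)
pose V : finType := {ffun 'I_(2 * m) -> 'I_r.+2}.
pose pairing (p : V * V) := [ffun i => (p.1 i, p.2 i)].
rewrite (@fibre_card_bij _ _ _ _ (fun p : V * V => \sum_i p.1 i * p.2 i) pairing); first last.
- by move=> [u v] /=; apply: eq_bigr => i _; rewrite ffunE.
- exists (fun x : {ffun 'I_(2 * m) -> 'I_r.+2 * 'I_r.+2} =>
    ([ffun i => (x i).1] : V, [ffun i => (x i).2] : V)) => [[u v]|x].
    by congr (_, _); apply/ffunP=> i; rewrite !ffunE.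
  by apply/ffunP=> i; rewrite !ffunE; case: (x i).
rewrite fibre_cardE -(pair_bigA _ (fun u v : V => ((\sum_i u i * v i)%R == n%:~R) : nat)) /=.
by apply: eq_bigr => u _; rewrite -(fibre_cardE (fun v : V => \sum_i u i * v i)) ffunE.
Qed.

Theorem corollary8 (m r : nat) (n : int) (a : 'I_(4 * m) -> int)
    (hm : (0 < m)%N) (hr : (0 < r)%N) (r_odd : odd r)
    (ha : \prod_(i < 4 * m) a i = 1) :
  (num_quad_sols n r a)%:R =
    r%:R ^+ (2 * m - 1) *
      \sum_(d <- divisors (gcdn `|n|%N r)) d%:R * jordan (2 * m) (r %/ d) :> rat.
Proof.
(* 'I_1 has no (nonzero) ring structure, so r = 1 is treated apart. *)
case: r hr r_odd => [//|[_ _|r _ r_odd]].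
  have -> : num_quad_sols n 1 a = 1%N.
    rewrite -[RHS](exp1n #|'I_(4 * m)|) -[X in _ = (X ^ _)%N](card_ord 1) -card_ffun.
    by apply: eq_card => x; rewrite !inE eqz_mod_dvd dvd1z.
  by rewrite gcdn1 expr1n mul1r big_seq1 divn1 /jordan big_nil expr1n !mulr1.
rewrite num_quad_sols_hyperbolic // -gcdn_intr_Zp.
(* Positivity of [m] ensures that [2 * m - 1] is not truncated. *)
have [s ->] : exists s, (2 * m = s.+1)%N by exists (2 * m).-1; lia.
by rewrite sum_gcd_family subn1.
Qed.
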